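(* Let $M$ be a rank $d$ matroid on $[n]$, which may or may not be realizable. Define a function $I\mapsto f_I$ from $\binom{[n]}{d}$ to $\Lambda$ as follows. If $I$ is not a basis of $M$, put $f_I=0$. If $I$ is a basis of $M$, let $S_I\subset\mathbb{Z}^n$ be the semigroup (containing $0$) generated by the vectors $e_j-e_i$ with $i\in I$, $j\in[n]\setminus I$ such that $I\cup\{j\}\setminus\{i\}$ is also a basis of $M$, let $h_I=\sum_{a\in S_I}x^a$, and put $$f_I=h_I\prod_{i\in I}\prod_{j\in[n]\setminus I}(1-x_j/x_i).$$ Then for every $B\in\binom{[n]}{d-1}$ and all $i,j\in[n]\setminus B$, $$f_{B\cup\{i\}}\equiv f_{B\cup\{j\}}\mod 1-x_i/x_j,$$ and thus $I\mapsto f_I$ defines a class in $K^T(G(d,n))$ and in $K^\circ(G(d,n))$.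
   Context: $[n]=\{1,\dots,n\}$ and $\binom{[n]}{k}$ is the set of $k$-element subsets of $[n]$. $\Lambda$ is the ring of Laurent polynomials of degree zero in $x_1,\dots,x_n$ with integer coefficients; for $a\in\mathbb{Z}^n$, $x^a=x_1^{a_1}\cdots x_n^{a_n}$. The series $h_I$ is regarded as a rational function (it is the Hilbert series of a finitely generated pointed semigroup). The congruence is in the ring $\Lambda$. $T=(\mathbb{C}^* )^n/\mathrm{diag}(\mathbb{C}^* )$ acts on the Grassmannian $G(d,n)$ of $d$-planes in $\mathbb{C}^n$. The $T$-equivariant $K$-theory $K^T(G(d,n))$ is identified with the ring of functions $I\mapsto f_I$ from $\binom{[n]}{d}$ to $\Lambda$ such that $f_{B\cup\{i\}}\equiv f_{B\cup\{j\}}\mod 1-x_i/x_j$ for every $B\in\binom{[n]}{d-1}$ and $i,j\in[n]\setminus B$. The ordinary $K$-theory is $K^\circ(G(d,n))\cong K^T(G(d,n))\otimes_\Lambda\mathbb{Z}$, where every monomial of $\Lambda$ acts on $\mathbb{Z}$ by $1$. *)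

(* Defs.v *)
From HB Require Import structures.
From mathcomp Require Import all_boot all_order all_algebra.
From mathcomp Require Import boolp classical_sets.
From mathcomp Require Import freeg mpoly.

Set Implicit Arguments.
Unset Strict Implicit.
Unset Printing Implicit Defensive.

Import GRing.Theory.
Local Open Scope ring_scope.

(* The ground set [n] = {1, ..., n} is the ordinal type 'I_n, counted from 0. *)

Record matroid (n d : nat) := Matroid {
  bases : {set {set 'I_n}};
  bases_neq0 : bases != finset.set0;
  card_basis : forall I, I \in bases -> #|I| = d;
  basis_exchange : forall I J, I \in bases -> J \in bases ->
    forall i, i \in I :\: J ->
    exists2 j, j \in J :\: I & (j |: (I :\ i)) \in bases }.

Definition dsubset (n d : nat) := {I : {set 'I_n} | #|I| == d}.

(* Q(x_1, ..., x_n), as the fraction field of Z[x_1, ..., x_n]. *)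
Notation ratfun n := {fraction {mpoly int[n]}}.
Notation polyF := (@FracField.tofrac {mpoly int[_]}).

Definition xvar n (i : 'I_n) : ratfun n := polyF 'X_i.

(* Lambda: a Laurent polynomial is p / x^m with p a polynomial and x^m a
   monomial, and it has degree zero iff p is homogeneous of degree |m|. *)
Definition laurent_form n (f : ratfun n) (mp : 'X_{1..n} * {mpoly int[n]}) :=
  mp.2 \is (mdeg mp.1).-homog /\ f = polyF mp.2 / polyF 'X_[mp.1].

Definition laurent0 n : {pred ratfun n} :=
  fun f => `[< exists mp, laurent_form f mp >].

Lemma polyF_inj n : injective (polyF : {mpoly int[n]} -> ratfun n).
Proof. by move=> p q /eqP; rewrite tofrac_eq => /eqP. Qed.

Lemma polyFX_neq0 n (m : 'X_{1..n}) : polyF 'X_[m] != 0 :> ratfun n.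
Proof.
rewrite -(rmorph0 (@FracField.tofrac {mpoly int[n]})) (inj_eq (@polyF_inj n)).
by apply/eqP => /(congr1 (mcoeff m))/eqP; rewrite mcoeffX eqxx mcoeff0.
Qed.

Lemma laurent_form1 n : laurent_form (1 : ratfun n) (0%MM, 1).
Proof.
split=> /=; first by rewrite mdeg0 dhomog1.
by rewrite mpolyX0 divff // rmorph1 oner_neq0.
Qed.

Lemma laurent_formB n (f g : ratfun n) m p m' p' :
  laurent_form f (m, p) -> laurent_form g (m', p') ->
  laurent_form (f - g) ((m + m')%MM, p * 'X_[m'] - p' * 'X_[m]).
Proof.
move=> [/= hp ->] [/= hp' ->]; split=> /=.
  rewrite mdegD rpredB //; first by rewrite dhomogM // dhomogX.
  by rewrite addnC dhomogM // dhomogX.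
rewrite -mulNr addf_div ?polyFX_neq0 // mulNr.
by rewrite mpolyXD rmorphB !rmorphM.
Qed.

Lemma laurent_formM n (f g : ratfun n) m p m' p' :
  laurent_form f (m, p) -> laurent_form g (m', p') ->
  laurent_form (f * g) ((m + m')%MM, p * p').
Proof.
move=> [/= hp ->] [/= hp' ->]; split=> /=.
  by rewrite mdegD dhomogM.
by rewrite mpolyXD !rmorphM /= mulf_div.
Qed.

Lemma laurent0_subring_closed n : subring_closed (@laurent0 n).
Proof.
split.
- by apply/asboolP; exists (0%MM, 1); exact: laurent_form1.
- move=> f g /asboolP[[m p] hf] /asboolP[[m' p'] hg].
  by apply/asboolP; eexists; exact: laurent_formB hf hg.
- move=> f g /asboolP[[m p] hf] /asboolP[[m' p'] hg].
  by apply/asboolP; eexists; exact: laurent_formM hf hg.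
Qed.

HB.instance Definition _ n :=
  GRing.isSubringClosed.Build (ratfun n) (@laurent0 n)
    (@laurent0_subring_closed n).

Record Lambda (n : nat) := MkLambda {
  Lambda_val :> ratfun n;
  _ : Lambda_val \in @laurent0 n }.

HB.instance Definition _ n := [isSub for @Lambda_val n].
HB.instance Definition _ n := [Choice of Lambda n by <:].
HB.instance Definition _ n :=
  [SubChoice_isSubComNzRing of Lambda n by <:].

(* u = v mod m in the ring Lambda: the quotient is required to lie in Lambda. *)
Definition eqmod_Lambda n (m u v : ratfun n) :=
  exists2 g, g \in @laurent0 n & u - v = m * g.

(* K^T(G(d,n)).  The (d-1)-subset B is implicit in I = B u {i}, J = B u {j}. *)
Definition KT_cond n d (f : {ffun dsubset n d -> (Lambda n)^o}) : bool :=
  `[< forall (B : {set 'I_n}) (i j : 'I_n) (I J : dsubset n d),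
        i \notin B -> j \notin B -> val I = i |: B -> val J = j |: B ->
        eqmod_Lambda (1 - xvar i / xvar j) (Lambda_val (f I))
          (Lambda_val (f J)) >].

Lemma KT_subring_closed n d : subring_closed (@KT_cond n d).
Proof.
split.
- apply/asboolP=> B i j I J _ _ _ _; exists 0; first exact: rpred0.
  by rewrite !ffunE subrr mulr0.
- move=> f g /asboolP hf /asboolP hg; apply/asboolP=> B i j I J hi hj hI hJ.
  have [a ha ea] := hf _ _ _ _ _ hi hj hI hJ.
  have [b hb eb] := hg _ _ _ _ _ hi hj hI hJ.
  exists (a - b); first exact: rpredB.
  have vB K : Lambda_val ((f - g) K) = Lambda_val (f K) - Lambda_val (g K).
    by rewrite !ffunE.
  by rewrite !vB mulrBr -ea -eb !opprD !opprK addrACA.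
- move=> f g /asboolP hf /asboolP hg; apply/asboolP=> B i j I J hi hj hI hJ.
  have [a ha ea] := hf _ _ _ _ _ hi hj hI hJ.
  have [b hb eb] := hg _ _ _ _ _ hi hj hI hJ.
  exists (a * Lambda_val (g I) + Lambda_val (f J) * b).
    by rewrite rpredD // rpredM //; exact: valP.
  have vM K : Lambda_val ((f * g) K) = Lambda_val (f K) * Lambda_val (g K).
    by rewrite !ffunE.
  rewrite !vM mulrDr mulrA -ea mulrCA -eb.
  by rewrite mulrBl mulrBr addrA subrK.
Qed.

Lemma KT_submod_closed n d : submod_closed (@KT_cond n d).
Proof.
have [_ hB hM] := KT_subring_closed n d.
have h1 a : [ffun => a] \in @KT_cond n d.
  apply/asboolP=> B i j I J _ _ _ _; exists 0; first exact: rpred0.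
  by rewrite !ffunE subrr mulr0.
have h0 : 0 \in @KT_cond n d by exact: h1 0.
split=> // a f g hf hg.
have -> : a *: f + g = [ffun => a] * f - (0 - g).
  by rewrite sub0r opprK; congr (_ + g); apply/ffunP=> I; rewrite !ffunE.
by apply: (hB) => //; [exact: hM | exact: hB].
Qed.

HB.instance Definition _ n d :=
  GRing.isSubringClosed.Build {ffun dsubset n d -> (Lambda n)^o} (@KT_cond n d)
    (@KT_subring_closed n d).
HB.instance Definition _ n d :=
  GRing.isSubmodClosed.Build (Lambda n) {ffun dsubset n d -> (Lambda n)^o}
    (@KT_cond n d) (@KT_submod_closed n d).

Record KT (n d : nat) := MkKT {
  KT_val :> {ffun dsubset n d -> (Lambda n)^o};
  _ : KT_val \in @KT_cond n d }.

HB.instance Definition _ n d := [isSub for @KT_val n d].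
HB.instance Definition _ n d := [Choice of KT n d by <:].
HB.instance Definition _ n d :=
  GRing.SubChoice_isSubPzRing.Build {ffun dsubset n d -> (Lambda n)^o}
    (@KT_cond n d) (KT n d) (@KT_subring_closed n d).
HB.instance Definition _ n d := [SubZmodule_isSubLmodule of KT n d by <:].

(* Z as a Lambda-module: every monomial acts by 1, i.e. a Laurent polynomial
   acts by its value at x = (1, ..., 1). *)
Definition aug n (u : Lambda n) : int :=
  meval (fun=> 1) (projT1 (cid (asboolW (valP u)))).2.

Lemma augE n (u : Lambda n) m p :
  laurent_form (Lambda_val u) (m, p) -> aug u = p.@[fun=> 1].
Proof.
rewrite /aug; case: cid => -[m' p'] /= [_ /= e'] [_ /= e].
move: e; rewrite e' => /eqP; rewrite eqr_div ?polyFX_neq0 // -!rmorphM /=.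
move/eqP/polyF_inj/(congr1 (meval (fun=> 1))).
have hX (k : 'X_{1..n}) : ('X_[k] : {mpoly int[n]}).@[fun=> 1] = 1.
  by rewrite mevalX big1 // => ? _; rewrite expr1n.
by rewrite !rmorphM /= !hX !mulr1.
Qed.

Lemma aug_is_zmod_morphism n : zmod_morphism (@aug n).
Proof.
move=> u v; have /asboolP[[m p] hu] := valP u.
have /asboolP[[m' p'] hv] := valP v.
rewrite (augE hu) (augE hv) (@augE n (u - v) _ _ (laurent_formB hu hv)).
by rewrite mevalB !mevalM !mevalX !big1 ?mulr1 // => i _; rewrite expr1n.
Qed.

Lemma aug_is_monoid_morphism n : monoid_morphism (@aug n).
Proof.
split; first by rewrite (@augE n 1 _ _ (laurent_form1 n)) meval1.
move=> u v; have /asboolP[[m p] hu] := valP u.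
have /asboolP[[m' p'] hv] := valP v.
by rewrite (augE hu) (augE hv) (@augE n (u * v) _ _ (laurent_formM hu hv)) mevalM.
Qed.

HB.instance Definition _ n :=
  GRing.isZmodMorphism.Build (Lambda n) int (@aug n)
    (@aug_is_zmod_morphism n).
HB.instance Definition _ n :=
  GRing.isMonoidMorphism.Build (Lambda n) int (@aug n)
    (@aug_is_monoid_morphism n).

Definition Zaug (n : nat) : Type := int.
HB.instance Definition _ n := GRing.Zmodule.on (Zaug n).

Definition Zaug_scale n (u : Lambda n) (z : Zaug n) : Zaug n := aug u * z.

Fact Zaug_scaleA n (u v : Lambda n) z :
  Zaug_scale u (Zaug_scale v z) = Zaug_scale (u * v) z.
Proof. by rewrite /Zaug_scale rmorphM mulrA. Qed.
Fact Zaug_scale1 n : left_id 1 (@Zaug_scale n).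
Proof. by move=> z; rewrite /Zaug_scale rmorph1 mul1r. Qed.
Fact Zaug_scaleDr n : right_distributive (@Zaug_scale n) +%R.
Proof. by move=> u z t; exact: mulrDr. Qed.
Fact Zaug_scaleDl n z : {morph (@Zaug_scale n)^~ z : u v / u + v}.
Proof. by move=> u v; rewrite /Zaug_scale rmorphD; exact: mulrDl. Qed.

HB.instance Definition _ n :=
  GRing.Zmodule_isLmodule.Build (Lambda n) (Zaug n)
    (@Zaug_scaleA n) (@Zaug_scale1 n) (@Zaug_scaleDr n) (@Zaug_scaleDl n).

Section Tensor.
Variables (A : comPzRingType) (U V : lmodType A).

Local Notation gen u v := (<< (u, v) >> : {freeg (U * V) / int}).

Inductive tensor_rel : {freeg (U * V) / int} -> Prop :=
| tensor_rel0 : tensor_rel 0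
| tensor_relB x y : tensor_rel x -> tensor_rel y -> tensor_rel (x - y)
| tensor_relDl u u' v : tensor_rel (gen (u + u') v - (gen u v + gen u' v))
| tensor_relDr u v v' : tensor_rel (gen u (v + v') - (gen u v + gen u v'))
| tensor_relZ a u v : tensor_rel (gen (a *: u) v - gen u (a *: v)).

Definition tensor_relb : {pred {freeg (U * V) / int}} :=
  fun x => `[< tensor_rel x >].

Fact tensor_relb_closed : zmod_closed tensor_relb.
Proof.
split; first by apply/asboolP; exact: tensor_rel0.
by move=> x y /asboolP hx /asboolP hy; apply/asboolP; exact: tensor_relB.
Qed.
HB.instance Definition _ :=
  GRing.isZmodClosed.Build {freeg (U * V) / int} tensor_relb
    tensor_relb_closed.

(* U (x)_A V, as an abelian group. *)
Definition tensor : zmodType := Quotient.quot tensor_relb.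

Definition tens (u : U) (v : V) : tensor :=
  \pi_(Quotient.quot tensor_relb)%qT (gen u v).

End Tensor.

(* The underlying group of K(G(d,n)) = K^T(G(d,n)) (x)_Lambda Z; the image in
   it of an equivariant class c is c (x) 1. *)
Definition Kord (n d : nat) := tensor (KT n d) (Zaug n).
Definition Kord_class n d (c : KT n d) : Kord n d := 
  tens (c : KT n d) (1%Z : Zaug n).

(* Formal series sum_(a in Z^n) s(a) x^a, with no condition on the support. *)
Definition series (n : nat) := 'rV[int]_n -> int.

Definition mnm_vec n (m : 'X_{1..n}) : 'rV[int]_n := \row_i (m i)%:Z.

Definition poly_mul_series n (p : {mpoly int[n]}) (s : series n) : series n :=
  fun a => \sum_(m <- msupp p) p@_m * s (a - mnm_vec m).

Definition one_series n : series n := fun a => (a == 0)%:R.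

(* The series s is the rational function r: writing r = p / q, the series
   q * s and p coincide.  Such an r is unique when it exists: if also
   q' * s = p' then q' * p = q' * q * s = q * p'.  When no such r exists,
   rat_of_series s is 0. *)
Definition series_rat n (s : series n) (r : ratfun n) :=
  exists p q : {mpoly int[n]},
    [/\ q != 0, r = polyF p / polyF q &
        poly_mul_series q s = poly_mul_series p (@one_series n)].

Definition rat_of_series n (s : series n) : ratfun n :=
  xget 0 [set r | series_rat s r]%classic.

Inductive semigroup_gen n (G : 'rV[int]_n -> Prop) : 'rV[int]_n -> Prop :=
| semigroup_gen0 : semigroup_gen G 0
| semigroup_genD g a : G g -> semigroup_gen G a -> semigroup_gen G (g + a).

Definition indicator_series n (S : 'rV[int]_n -> Prop) : series n :=
  fun a => `[< S a >]%:R.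

Section MatroidClass.
Variables (n d : nat) (M : matroid n d).

Definition evec (i : 'I_n) : 'rV[int]_n := delta_mx 0 i.

Definition exchange_vec (I : {set 'I_n}) (g : 'rV[int]_n) :=
  exists i j, [/\ i \in I, j \notin I, (j |: I) :\ i \in bases M
                & g = evec j - evec i].

Definition S_ (I : {set 'I_n}) := semigroup_gen (exchange_vec I).

Definition hseries (I : {set 'I_n}) := indicator_series (S_ I).

Definition h_ (I : {set 'I_n}) : ratfun n := rat_of_series (hseries I).

Definition f_ (I : {set 'I_n}) : ratfun n :=
  if I \in bases M then
    h_ I * \prod_(i in I) \prod_(j in ~: I) (1 - xvar j / xvar i)
  else 0.

End MatroidClass.

(* Main.v *)
Require Import Defs.
From mathcomp Require Import all_boot all_order all_algebra.
From mathcomp Require Import boolp.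
From mathcomp Require classical_sets.
From mathcomp Require Import freeg mpoly ssrcomplements.
From mathcomp Require Import zify ring.

Set Implicit Arguments.
Unset Strict Implicit.
Unset Printing Implicit Defensive.

Import GRing.Theory.
Local Open Scope ring_scope.

(** Formal series on Z^n form a module over Z[x_1, ..., x_n], the action of p on
    s being written p ** s; a series represents the fraction r when some
    nonzero q makes q ** s a polynomial p with r = p / q.  All the arguments
    take place in this module, where supports can be controlled, and are carried
    over to fractions by the fact that a series represents at most one
    of them.

    Rationality.  Let S be a monoid generated by finitely many vectors v_e.
    Among the exponent vectors m with sum_e m_e v_e = a keep the least one for
    a monomial order.  The set D of the vectors kept is closed under decreasing
    the exponents, so by Dickson's lemma membership in D depends only on the
    exponents cut off at some constant C ([down_closed_trunc]).  Sorting D by the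
    cut-off vector splits S into finitely many translates of free cones, and a
    factor 1 - x^v_e for each direction reduces such a cone to its apex.
    Hence the product of the 1 - x^v_e turns the series of S into a Laurent
    polynomial ([fin_supp_semigroup]).  For a basis I this says that h_I times
    the product of the 1 - x_j / x_i over the exchanges (i, j) of I lies in
    Lambda; the other factors of f_I only multiply it further.  In particular
    f_I is in Lambda, and it is divisible by 1 - x_j / x_i whenever exchanging
    i for j does not give a basis; this settles the congruence when only one of
    the two subsets is a basis.

    Congruence.  Let I = B + i and J = B + j be bases and v = e_j - e_i.  A line
    parallel to v meets S_I either in the empty set or in a half line going to
    infinity in the direction v, and S_J in the empty set or in a half line
    going in the direction - v.  The exchange axiom says that S_I and S_J meet
    the same lines ([exchange_project], [line_hull_exchange]); let T be the
    indicator series of the union of these lines.  After clearing monomials, the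
    difference f_I - f_J corresponds to
      r_I (X_i - X_j) ** h_I + r_J (X_i - X_j) ** h_J
    with polynomials r_I, r_J that are exchanged by swapping x_i and x_j.  As
    (X_i - X_j) ** T = 0, it equals (X_i - X_j) ** e with
      e = r_I ** h_I + r_J ** h_J - r_I ** T,
    and r_I ** T = r_J ** T because x_i and x_j act on T in the same way.  Along
    every line e vanishes far in the direction v, where h_I agrees with T and
    h_J is zero, and far in the direction - v, where the roles are reversed.
    Since (X_i - X_j) ** e has finite support, so has e ([fin_supp_line]); hence e
    gives an element of Lambda, which is the quotient that is needed. *)

Local Notation "p ** s" := (poly_mul_series p s)
  (at level 41, right associativity).

(** * Formal series as a module over the polynomial ring *)

Lemma mnm_vec0 n : mnm_vec (0%MM : 'X_{1..n}) = 0.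
Proof. by apply/rowP=> t; rewrite !mxE mnm0E. Qed.

Lemma mnm_vecD n (m m' : 'X_{1..n}) :
  mnm_vec (m + m')%MM = mnm_vec m + mnm_vec m'.
Proof. by apply/rowP=> t; rewrite !mxE mnmDE PoszD. Qed.

Lemma mnm_vec1 n (i : 'I_n) : mnm_vec U_(i)%MM = evec i.
Proof. by apply/rowP=> t; rewrite !mxE mnm1E eqxx /= eq_sym; case: eqP. Qed.

Lemma mnm_vec_inj n : injective (@mnm_vec n).
Proof.
move=> m m' e; apply/mnmP=> t.
by move/rowP/(_ t): e; rewrite !mxE => -[].
Qed.

Lemma act_wide n (p : {mpoly int[n]}) k : (msize p <= k)%N -> forall s a,
  (p ** s) a = \sum_(m : 'X_{1..n < k}) p@_m * s (a - mnm_vec m).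
Proof.
move=> lepk s a; pose I : subFinType _ := 'X_{1..n < k}.
rewrite /poly_mul_series (big_mksub I) //=; first last.
- by move=> x /msize_mdeg_lt /leq_trans; apply.
- by rewrite msupp_uniq.
by rewrite big_rmcond //= => i; move/memN_msupp_eq0 ->; rewrite mul0r.
Qed.

Lemma act_linear n c (p q : {mpoly int[n]}) s a :
  ((c *: p + q) ** s) a = c * (p ** s) a + (q ** s) a.
Proof.
pose k := maxn (msize (c *: p + q)) (maxn (msize p) (msize q)).
rewrite (@act_wide n (c *: p + q) k) ?(@act_wide n p k) ?(@act_wide n q k);
  rewrite ?leq_max ?leqnn ?orbT //.
rewrite mulr_sumr -big_split /=; apply: eq_bigr => m _.
by rewrite mcoeffD mcoeffZ mulrDl mulrA.
Qed.

Lemma act0p n (s : series n) : 0 ** s = fun=> 0.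
Proof. by apply/funext=> a; rewrite /poly_mul_series msupp0 big_nil. Qed.

Lemma actB n (p q : {mpoly int[n]}) s : (p - q) ** s = (p ** s) \- (q ** s).
Proof.
by apply/funext=> a; rewrite -scaleN1r addrC act_linear mulN1r addrC.
Qed.

Lemma actX n (m : 'X_{1..n}) s a : ('X_[m] ** s) a = s (a - mnm_vec m).
Proof. by rewrite /poly_mul_series msuppX big_seq1 mcoeffX eqxx mul1r. Qed.

Lemma act1 n (s : series n) : 1 ** s = s.
Proof. by apply/funext=> a; rewrite -mpolyX0 actX mnm_vec0 subr0. Qed.

Lemma actM n (p q : {mpoly int[n]}) s : (p * q) ** s = p ** q ** s.
Proof.
apply/funext=> a; elim/mpolyind: p a => [|c m p _ _ IH] a.
  by rewrite mul0r !act0p.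
rewrite mulrDl -scalerAl !act_linear IH; congr (_ * _ + _).
rewrite actX; elim/mpolyind: q a {IH} => [|c' m' q _ _ IH] a.
  by rewrite mulr0 !act0p.
rewrite mulrDr -scalerAr !act_linear IH; congr (_ * _ + _).
by rewrite -mpolyXD !actX mnm_vecD opprD addrA.
Qed.

Lemma actC n (p q : {mpoly int[n]}) s : p ** q ** s = q ** p ** s.
Proof. by rewrite -!actM mulrC. Qed.

Lemma act_addr n (p : {mpoly int[n]}) (s s' : series n) :
  p ** (s \+ s') = (p ** s) \+ (p ** s').
Proof.
apply/funext=> a; rewrite /poly_mul_series /= -big_split /=.
by apply: eq_bigr => m _; rewrite mulrDr.
Qed.

Lemma act_subr n (p : {mpoly int[n]}) (s s' : series n) :
  p ** (s \- s') = (p ** s) \- (p ** s').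
Proof.
apply/funext=> a; rewrite /poly_mul_series /= -sumrB.
by apply: eq_bigr => m _; rewrite mulrBr.
Qed.

(** The series [one_series] generates a free submodule: a polynomial can be read
    off from its action on it. *)
Lemma act_one n (p : {mpoly int[n]}) m : (p ** @one_series n) (mnm_vec m) = p@_m.
Proof.
rewrite /poly_mul_series /one_series.
have e m' : (mnm_vec m - mnm_vec m' == 0) = (m' == m).
  by rewrite subr_eq0 (inj_eq (@mnm_vec_inj n)) eq_sym.
case: (boolP (m \in msupp p)) => hm.
  rewrite (bigD1_seq m) ?msupp_uniq //= e eqxx mulr1 big1 ?addr0 // => m' ne.
  by rewrite e (negbTE ne) mulr0.
rewrite (memN_msupp_eq0 hm) big1_seq // => m' /= hm'; rewrite e.
by case: eqP hm' => [->|_]; [rewrite (negbTE hm) | rewrite mulr0].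
Qed.

Lemma act_one_inj n (p q : {mpoly int[n]}) :
  p ** @one_series n = q ** @one_series n -> p = q.
Proof. by move=> e; apply/mpolyP=> m; rewrite -!act_one e. Qed.

(** * Series representing rational functions *)

Lemma polyF_eq0 n (p : {mpoly int[n]}) : (polyF p == 0 :> ratfun n) = (p == 0).
Proof. by rewrite tofrac_eq0. Qed.

Lemma series_rat_inj n (s : series n) r r' :
  series_rat s r -> series_rat s r' -> r = r'.
Proof.
move=> [p [q [q0 -> e]]] [p' [q' [q'0 -> e']]].
apply/eqP; rewrite eqr_div ?polyF_eq0 // -!rmorphM; apply/eqP; congr (polyF _).
by apply: act_one_inj; rewrite (mulrC p) (mulrC p') !actM -e -e' actC.
Qed.

(** Turns the choice operator in the value of a series into an equation, once
    some fraction represented by the series is known. *)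
Lemma rat_of_seriesE n (s : series n) r : series_rat s r -> rat_of_series s = r.
Proof.
move=> h; apply: (@series_rat_inj n s) => //.
exact: (classical_sets.xgetPex 0 (ex_intro _ r h)).
Qed.

Lemma series_rat_act n (s : series n) r p :
  series_rat s r -> series_rat (p ** s) (polyF p * r).
Proof.
move=> [p' [q [q0 -> e]]]; exists (p * p'), q; split=> //.
  by rewrite rmorphM mulrA.
by rewrite actC e actM.
Qed.

(** Fractions can be divided although series cannot: a denominator of p ** s
    yields a denominator of s. *)
Lemma series_rat_div n (s : series n) r p :
  p != 0 -> series_rat (p ** s) r -> series_rat s (r / polyF p).
Proof.
move=> p0 [p' [q [q0 -> e]]]; exists p', (q * p); split=> //.
- by rewrite mulf_neq0.
- by rewrite rmorphM invfM mulrA.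
by rewrite actM.
Qed.

Lemma series_ratB n (s s' : series n) r r' :
  series_rat s r -> series_rat s' r' -> series_rat (s \- s') (r - r').
Proof.
move=> [p [q [q0 -> e]]] [p' [q' [q'0 -> e']]].
exists (p * q' - p' * q), (q * q'); split; first by rewrite mulf_neq0.
- by rewrite -mulNr addf_div ?polyF_eq0 // mulNr rmorphB !rmorphM.
rewrite act_subr actB actM actC e -actM mulrC.
by rewrite (mulrC p) (mulrC p') !actM e'; congr (_ \- _); rewrite actC.
Qed.

(** * Finite series of degree zero are elements of Lambda *)

Definition fin_supp n (s : series n) :=
  exists R : nat, forall a, s a != 0 -> forall t, (absz (a 0%R t) <= R)%N.

Definition coord_sum n (a : 'rV[int]_n) : int := \sum_t a 0 t.

(** Degrees are integers rather than naturals so that series with negative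
    exponents are covered. *)
Definition hom_supp n (k : int) (s : series n) :=
  forall a, s a != 0 -> coord_sum a = k.

Lemma coord_sumD n (a b : 'rV[int]_n) : coord_sum (a + b) = coord_sum a + coord_sum b.
Proof. by rewrite /coord_sum -big_split; apply: eq_bigr => t _; rewrite mxE. Qed.

Lemma coord_sumB n (a b : 'rV[int]_n) : coord_sum (a - b) = coord_sum a - coord_sum b.
Proof. by rewrite /coord_sum -sumrB; apply: eq_bigr => t _; rewrite !mxE. Qed.

Lemma coord_sum_mnm n (m : 'X_{1..n}) : coord_sum (mnm_vec m) = (mdeg m)%:Z.
Proof.
rewrite /coord_sum mdegE -[RHS]natz natr_sum.
by apply: eq_bigr => t _; rewrite mxE natz.
Qed.

Lemma act_neq0 n (p : {mpoly int[n]}) s a : (p ** s) a != 0 ->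
  exists2 m, m \in msupp p & s (a - mnm_vec m) != 0.
Proof.
apply: contra_neqP => h; rewrite /poly_mul_series big1_seq // => m /= hm.
have [-> | ne] := eqVneq (s (a - mnm_vec m)) 0; first by rewrite mulr0.
by case: h; exists m.
Qed.

Lemma fin_supp_act n (p : {mpoly int[n]}) s : fin_supp s -> fin_supp (p ** s).
Proof.
move=> [R hR]; exists (R + msize p)%N => a /act_neq0[m hm /hR h] t.
move: (h t); rewrite !mxE.
have := msize_mdeg_lt hm.
have : (m t <= mdeg m)%N by rewrite mdegE (bigD1 t) //= leq_addr.
by move: (m t) (mdeg m) (msize p) (a 0 t) => x y z u; lia.
Qed.

Lemma hom_supp_act n (p : {mpoly int[n]}) k l s :
  p \is k.-homog -> hom_supp l s -> hom_supp (l + k%:Z) (p ** s).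
Proof.
move=> hp hs a /act_neq0[m hm /hs]; rewrite coord_sumB coord_sum_mnm.
by rewrite (dhomog_mf hp hm) => <-; rewrite subrK.
Qed.

Lemma hom_suppB n k (s s' : series n) :
  hom_supp k s -> hom_supp k s' -> hom_supp k (s \- s').
Proof.
move=> h h' a; have [e|/h //] := eqVneq (s a) 0.
by rewrite /= e sub0r oppr_eq0 => /h'.
Qed.

Lemma fin_suppD n (s s' : series n) :
  fin_supp s -> fin_supp s' -> fin_supp (s \+ s').
Proof.
move=> [R h] [R' h']; exists (R + R')%N => a ha t.
have [e|/h/(_ t)] := eqVneq (s a) 0; last by lia.
by move: ha; rewrite /= e add0r => /h'/(_ t); lia.
Qed.

Lemma fin_suppB n (s s' : series n) :
  fin_supp s -> fin_supp s' -> fin_supp (s \- s').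
Proof.
move=> [R h] [R' h']; exists (R + R')%N => a ha t.
have [e|/h/(_ t)] := eqVneq (s a) 0; last by lia.
by move: ha; rewrite /= e sub0r oppr_eq0 => /h'/(_ t); lia.
Qed.

Lemma finite_poly n (s : series n) :
  fin_supp s -> (forall a, s a != 0 -> forall t, 0 <= a 0 t) ->
  exists p : {mpoly int[n]}, s = p ** @one_series n.
Proof.
move=> [R hR] h0; pose k := (n * R).+1.
pose p := \sum_(m : 'X_{1..n < k}) s (mnm_vec m) *: 'X_[m] : {mpoly int[n]}.
have hp m : p@_m = s (mnm_vec m).
  have [lt|le] := ltnP (mdeg m) k; first exact: (mcoeff_mpoly (fun m => s (mnm_vec m))).
  transitivity (0 : int).
    rewrite raddf_sum big1 //= => m' _; rewrite mcoeffZ mcoeffX.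
    case: eqP => [e|]; last by rewrite mulr0.
    by move: le; rewrite -e leqNgt bmdeg.
  apply/esym; have [//|ne] := eqVneq (s (mnm_vec m)) 0.
  suff: (mdeg m <= n * R)%N by rewrite leqNgt le.
  rewrite mdegE -[X in (_ <= X * _)%N]card_ord -sum_nat_const leq_sum // => t _.
  by have := hR _ ne t; rewrite mxE.
exists p; apply/funext=> a.
have [h|] := pselect (forall t, 0 <= a 0 t).
  have -> : a = mnm_vec [multinom absz (a 0%R t) | t < n].
    by apply/rowP=> t; rewrite mxE mnmE gez0_abs.
  by rewrite act_one hp.
move=> hn; transitivity (0 : int).
  by apply/eqP; apply: contrapT => /negP/h0.
apply/esym/eqP; apply: contrapT => /negP/act_neq0[m _].
rewrite /one_series subr_eq0.
have [e _|_] := eqVneq a (mnm_vec m); last by rewrite eqxx.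
apply: hn => t.
by rewrite e mxE.
Qed.

Lemma homog_act_one n (p : {mpoly int[n]}) k :
  hom_supp k%:Z (p ** @one_series n) -> p \is k.-homog.
Proof.
move=> h; apply/dhomogP => m; rewrite mcoeff_msupp -act_one => /h.
by rewrite coord_sum_mnm => -[].
Qed.

Fact ge0_of_absz_subn (x : int) (k : nat) : (absz (x - k%:Z) <= k)%N -> 0 <= x.
Proof. by lia. Qed.

(** A monomial with large exponents moves a finite support into the positive
    orthant, where the series is a polynomial. *)
Lemma finite_laurent0 n (s : series n) : fin_supp s -> hom_supp 0 s ->
  exists2 f, f \in @laurent0 n & series_rat s f.
Proof.
move=> hf hh; have [R hR] := hf.
pose m := [multinom R | t < n].
have [|p hp] := @finite_poly n ('X_[m] ** s) (fin_supp_act _ hf).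
  move=> a; rewrite actX => /hR h t; have := h t; rewrite !mxE mnmE.
  exact: ge0_of_absz_subn.
exists (polyF p / polyF 'X_[m]).
  apply/asboolP; exists (m, p); split=> //=.
  apply: homog_act_one; rewrite -hp -[X in hom_supp X]add0r.
  by apply: hom_supp_act => //; rewrite dhomogX.
exists p, 'X_[m]; split=> //.
by rewrite -polyF_eq0 polyFX_neq0.
Qed.

(** * Semigroup series become finite after multiplication *)

Definition truncm k (C : nat) (m : 'X_{1..k}) : 'X_{1..k} :=
  [multinom minn (m e) C | e < k].

Definition down_closed k (D : 'X_{1..k} -> Prop) :=
  forall m m' : 'X_{1..k}, (m <= m')%MM -> D m' -> D m.

(** This is Dickson's lemma for the vectors supported on T, by induction on T:
    the slices of D at the levels of a new coordinate t decrease, and they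
    become constant because the limit slice is determined by a finite box, each
    point of which leaves the slices at some level or never. *)
Lemma down_closed_trunc_on k (T : seq 'I_k) (D : 'X_{1..k} -> Prop) :
  down_closed D -> exists C, forall m : 'X_{1..k}, (forall e, e \notin T -> m e = 0%N) ->
    D (truncm C m) -> D m.
Proof.
elim: T D => [|t T IH] D hD.
  exists 0%N => m hm; suff -> : truncm 0 m = m by [].
  by apply/mnmP=> e; rewrite mnmE minn0 hm.
pose slice x : 'X_{1..k} -> Prop := fun m => D (m + U_(t) *+ x)%MM.
have hslice x : down_closed (slice x).
  by move=> m m' /mnm_lepP le; apply: hD; apply/mnm_lepP=> e; rewrite !mnmDE leq_add2r.
have slice_le x y m : (x <= y)%N -> slice y m -> slice x m.
  move=> le; apply: hD; apply/mnm_lepP=> e.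
  by rewrite !mnmDE !mulmnE leq_add2l leq_mul2l le orbT.
have [Cinf hinf] := IH (fun m => forall x, slice x m)
  (fun m m' le h x => hslice x _ _ le (h x)).
have /choice[Cx hCx] x := IH (slice x) (hslice x).
pose box (c : {ffun 'I_k -> 'I_Cinf.+1}) : 'X_{1..k} := [multinom c e : nat | e < k].
(* bx c is a level at which the box point c has left the slices, if it ever does;
   c0 below is then a level from which all slices have the same box points. *)
have /choice[bx hbx] c : exists x, ~ (forall x, slice x (box c)) -> ~ slice x (box c).
  have [h|/existsNP[x hx]] := pselect (forall x, slice x (box c)); last by exists x.
  by exists 0%N.
pose c0 := \max_c bx c; pose C := maxn Cinf (maxn c0 (\max_(x < c0) Cx x)).
exists C => m hm.
pose m' : 'X_{1..k} := [multinom if e == t then 0%N else m e | e < k].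
have em : m = (m' + U_(t) *+ m t)%MM.
  apply/mnmP=> e; rewrite mnmDE mnmE mulmnE mnm1E eq_sym.
  by case: eqP => [->|]; rewrite ?mul1n ?add0n ?mul0n ?addn0.
have em' : truncm C m = (truncm C m' + U_(t) *+ minn (m t) C)%MM.
  apply/mnmP=> e; rewrite mnmDE !mnmE mulmnE mnm1E eq_sym.
  by case: eqP => [->|]; rewrite ?mul1n ?add0n ?mul0n ?addn0 ?min0n.
have hm' e : e \notin T -> m' e = 0%N.
  by rewrite mnmE; case: eqP => // ne he; rewrite hm // inE negb_or he andbT; apply/eqP.
have trunc_le C1 : (C1 <= C)%N -> (truncm C1 m' <= truncm C m')%MM.
  move=> le; apply/mnm_lepP=> e; rewrite ![truncm _ _ _]mnmE.
  by rewrite leq_min geq_minl (leq_trans (geq_minr _ _)).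
rewrite em' {2}em -/(slice _ _) -/(slice _ _) => hs.
have [lt|le] := ltnP (m t) c0.
  apply: hCx => //; apply: hslice (slice_le _ _ _ _ hs).
    apply: trunc_le; rewrite leq_max leq_max; apply/orP; right; apply/orP; right.
    exact: (leq_bigmax (Ordinal lt)).
  rewrite leq_min leqnn /= leq_max leq_max; apply/orP; right.
  by rewrite (ltnW lt).
apply: hinf => // {hCx}.
pose c : {ffun 'I_k -> 'I_Cinf.+1} := [ffun e => inord (minn (m' e) Cinf)].
have ec : truncm Cinf m' = box c.
  by apply/mnmP=> e; rewrite [LHS]mnmE [RHS]mnmE ffunE inordK // ltnS geq_minr.
rewrite ec; apply: contrapT => /hbx; apply; rewrite -ec.
apply: slice_le (hslice _ _ _ (trunc_le _ _) hs); last by rewrite leq_maxl.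
apply: (leq_trans (leq_bigmax c)); rewrite leq_min le /=.
by rewrite leq_max leq_max leqnn orbT.
Qed.

Lemma down_closed_trunc k (D : 'X_{1..k} -> Prop) : down_closed D ->
  exists C, forall m, D (truncm C m) -> D m.
Proof.
move=> /(@down_closed_trunc_on k (enum 'I_k))[C hC]; exists C => m; apply: hC.
by move=> e; rewrite mem_enum.
Qed.

Definition lincomb n k (v : 'I_k -> 'rV[int]_n) (m : 'X_{1..k}) : 'rV[int]_n :=
  \sum_e v e *+ m e.

Lemma lincombD n k (v : 'I_k -> 'rV[int]_n) m m' :
  lincomb v (m + m')%MM = lincomb v m + lincomb v m'.
Proof.
by rewrite /lincomb -big_split; apply: eq_bigr => e _; rewrite mnmDE mulrnDr.
Qed.

Lemma lincomb1 n k (v : 'I_k -> 'rV[int]_n) e : lincomb v U_(e)%MM = v e.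
Proof.
rewrite /lincomb (bigD1 e) //= mnm1E eqxx mulr1n big1 ?addr0 // => e' ne.
by rewrite mnm1E eq_sym (negbTE ne) mulr0n.
Qed.

Lemma lincomb0 n k (v : 'I_k -> 'rV[int]_n) : lincomb v 0%MM = 0.
Proof. by rewrite /lincomb big1 // => e _; rewrite mnm0E. Qed.

Lemma semigroup_lincomb n k (v : 'I_k -> 'rV[int]_n) a :
  semigroup_gen (fun g => exists e, g = v e) a <-> exists m, lincomb v m = a.
Proof.
split=> [|[m <-]].
  elim=> [|g b [e ->] _ [m <-]]; first by exists 0%MM; exact: lincomb0.
  by exists (U_(e) + m)%MM; rewrite lincombD lincomb1.
move: {2}(mdeg m) (erefl (mdeg m)) => d; elim: d m => [|d IH] m hm.
  move/eqP: hm; rewrite mdeg_eq0 => /eqP ->; rewrite lincomb0.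
  exact: semigroup_gen0.
have [e he] : exists e, m e != 0%N.
  apply: contrapT => /forallNP h; move: hm; rewrite mdegE big1 // => e _.
  by apply/eqP/negPn/negP.
have le : (U_(e) <= m)%MM by rewrite lep1mP.
rewrite -(submK le) addmC lincombD lincomb1; apply: semigroup_genD; first by exists e.
by apply: IH; move: hm; rewrite -{1}(submK le) mdegD mdeg1 addn1 => -[].
Qed.

(** The series of the image of a set of exponent vectors, each value counted
    once. *)
Definition shadow n k (v : 'I_k -> 'rV[int]_n) (B : 'X_{1..k} -> Prop) :
  series n := indicator_series (fun a => exists2 m, B m & lincomb v m = a).

Lemma indicator1 n (S : 'rV[int]_n -> Prop) a : S a -> indicator_series S a = 1.
Proof. by move=> h; rewrite /indicator_series asboolT. Qed.

Lemma indicator0 n (S : 'rV[int]_n -> Prop) a : ~ S a -> indicator_series S a = 0.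
Proof. by move=> h; rewrite /indicator_series asboolF. Qed.

Definition orthant k (c : 'X_{1..k}) (l : seq 'I_k) (m : 'X_{1..k}) :=
  (c <= m)%MM /\ forall e, e \notin l -> m e = c e.

(** On a free cone, subtracting the translate by a generator leaves the face
    where that generator is absent, so the factors peel off the directions one
    by one until the apex remains. *)
Lemma fin_supp_orthant n k (u w : 'I_k -> 'X_{1..n})
    (v := fun e => mnm_vec (w e) - mnm_vec (u e)) (c : 'X_{1..k}) (l : seq 'I_k) :
  uniq l ->
  (forall m m', orthant c l m -> orthant c l m' ->
     lincomb v m = lincomb v m' -> m = m') ->
  fin_supp ((\prod_(e <- l) ('X_[u e] - 'X_[w e])) ** shadow v (orthant c l)).
Proof.
elim: l => [_ _|t l IH /= /andP[tl ul] inj].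
  rewrite big_nil act1; exists (\max_t absz (lincomb v c 0%R t))%N => a ha t.
  suff -> : a = lincomb v c by exact: (leq_bigmax t).
  apply: contrapT => ne; move: ha; rewrite /shadow indicator0 ?eqxx //.
  case=> m [_ hm] ea; apply: ne; rewrite -ea; congr lincomb.
  by apply/mnmP=> e; exact: hm.
have sub m : orthant c l m -> orthant c (t :: l) m.
  by move=> [le h]; split=> // e; rewrite inE negb_or => /andP[_]; exact: h.
rewrite big_cons mulrC actM.
have -> : ('X_[u t] - 'X_[w t]) ** shadow v (orthant c (t :: l)) =
          'X_[u t] ** shadow v (orthant c l).
  apply/funext=> a; rewrite actB /= !actX.
  have -> : a - mnm_vec (w t) = a - mnm_vec (u t) - v t.
    by rewrite /v opprB addrA subrK.
  move: (a - _) => b; rewrite /shadow.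
  have step m : orthant c (t :: l) m -> orthant c (t :: l) (m + U_(t))%MM.
    move=> [le h]; split; first exact: lepm_trans le (lem_addr _ _).
    move=> e; rewrite inE negb_or => /andP[ne el].
    by rewrite mnmDE mnm1E eq_sym (negbTE ne) addn0 h // inE negb_or ne.
  have [[m hm eb]|nb] := pselect (exists2 m, orthant c (t :: l) m & lincomb v m = b).
    rewrite (@indicator1 _ _ b); last by exists m.
    have [hmt|hmt] := eqVneq (m t) (c t).
      rewrite indicator0 ?indicator1 ?subr0 //.
        exists m => //; split; first by case: hm.
        move=> e el; have [->//|ne] := eqVneq e t.
        by case: hm => _; apply; rewrite inE negb_or ne.
      case=> m' hm' eb'; have e : m = (m' + U_(t))%MM.
        by apply: inj => //; [exact: step | rewrite lincombD eb' lincomb1 subrK].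
      case: hm' => /mnm_lepP/(_ t); rewrite -hmt e mnmDE mnm1E eqxx addn1.
      by rewrite ltnn.
    have lt : (c t < m t)%N by rewrite ltn_neqAle eq_sym hmt; case: hm => /mnm_lepP/(_ t).
    have lem : (U_(t) <= m)%MM by rewrite lep1mP -lt0n (leq_ltn_trans _ lt).
    rewrite indicator1 ?indicator0 ?subrr //.
      case=> m' hm' eb'; have e := inj _ _ hm (sub _ hm') (etrans eb (esym eb')).
      by case: hm' => _ /(_ t tl); rewrite -e => /eqP; rewrite (negbTE hmt).
    exists (m - U_(t))%MM.
      split.
        apply/mnm_lepP=> e; rewrite mnmBE mnm1E.
        case: eqP => [<-|_]; first by rewrite leq_subRL ?add1n // (leq_ltn_trans _ lt).
        by rewrite subn0; case: hm => /mnm_lepP/(_ e).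
      move=> e; rewrite inE negb_or => /andP[ne el].
      rewrite mnmBE mnm1E eq_sym (negbTE ne) subn0.
      by case: hm => _; apply; rewrite inE negb_or ne.
    by rewrite -eb -{2}(submK lem) lincombD lincomb1 addrK.
  rewrite !indicator0 ?subr0 //.
    by case=> m hm eb; apply: nb; exists m => //; exact: sub.
  case=> m hm eb; apply: nb; exists (m + U_(t))%MM; first exact: step.
  by rewrite lincombD eb lincomb1 subrK.
rewrite actC; apply: fin_supp_act; apply: IH => // m m' hm hm'.
by apply: inj; exact: sub.
Qed.

Lemma act_sumr n (p : {mpoly int[n]}) (J : Type) (r : seq J) (F : J -> series n) :
  p ** (fun a => \sum_(j <- r) F j a) = fun a => \sum_(j <- r) (p ** F j) a.
Proof.
apply/funext=> a; rewrite /poly_mul_series exchange_big /=.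
by apply: eq_bigr => m _; rewrite mulr_sumr.
Qed.

Lemma fin_supp0 n : fin_supp ((fun=> 0) : series n).
Proof. by exists 0%N => a; rewrite eqxx. Qed.

Lemma fin_supp_sum n (J : Type) (r : seq J) (F : J -> series n) :
  (forall j, fin_supp (F j)) -> fin_supp (fun a => \sum_(j <- r) F j a).
Proof.
move=> h; elim: r => [|j r IH].
  by under eq_fun do rewrite big_nil; exact: fin_supp0.
by under eq_fun do rewrite big_cons; exact: fin_suppD.
Qed.

(** The monomial order picks one exponent vector for every element of the monoid;
    the vectors picked are cut into finitely many orthants by truncation, and
    the linear combination map is injective on each orthant since it is
    injective on all the vectors picked. *)
Lemma fin_supp_lincomb n k (u w : 'I_k -> 'X_{1..n})
    (v := fun e => mnm_vec (w e) - mnm_vec (u e)) :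
  fin_supp ((\prod_e ('X_[u e] - 'X_[w e])) **
            indicator_series (fun a => exists m, lincomb v m = a)).
Proof.
pose D m := forall m', lincomb v m' = lincomb v m -> (m <= m')%O.
have Dinj m m' : D m -> D m' -> lincomb v m = lincomb v m' -> m = m'.
  by move=> h h' e; apply/eqP; rewrite Order.POrderTheory.eq_le h // h'.
(* If m <= m' and p has the same value as m, then p + (m' - m) has the same value
   as m', hence is not smaller; cancel m' - m. *)
have hD : down_closed D.
  move=> m m' le h p e; rewrite -(lemc_add2l _ _ (m' - m)%MM) -[in X in (X <= _)%O]addmC.
  rewrite submK // addmC; apply: h; rewrite lincombD e -lincombD.
  by rewrite submK.
have exD a : (exists m, lincomb v m = a) -> exists2 m, D m & lincomb v m = a.
  case=> m; elim/(@ltmwf k): m => m IH ea.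
  have [h|/existsNP[m' /not_implyP[e' lt]]] := pselect (D m); first by exists m.
  apply: (IH m'); last by rewrite e'.
  by rewrite Order.TotalTheory.ltNge; apply/negP.
have [C hC] := down_closed_trunc hD.
pose box (c : {ffun 'I_k -> 'I_C.+1}) : 'X_{1..k} := [multinom c e : nat | e < k].
(* The free directions of a piece are those whose exponent reaches the cut-off. *)
pose l (c : {ffun 'I_k -> 'I_C.+1}) := [seq e <- enum 'I_k | box c e == C].
pose piece c : series n :=
  if pselect (D (box c)) then shadow v (orthant (box c) (l c)) else fun=> 0.
have ortho c m : orthant (box c) (l c) m -> box c = truncm C m.
  move=> [/mnm_lepP le h]; apply/mnmP=> e.
  have leC : (box c e <= C)%N by rewrite mnmE -ltnS.
  rewrite [RHS]mnmE; have [eC|ne] := eqVneq (box c e) C.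
    by rewrite eC; apply/esym/minn_idPr; rewrite -{1}eC.
  rewrite h; first by apply/esym/minn_idPl.
  by rewrite mem_filter (negbTE ne).
have orthoD c m : D (box c) -> orthant (box c) (l c) m -> D m.
  by move=> h /ortho e; apply: hC; rewrite -e.
have -> : indicator_series (fun a => exists m, lincomb v m = a) =
          fun a => \sum_c piece c a.
  apply/funext=> a.
  have pieceN c m : D m -> lincomb v m = a -> box c != truncm C m -> piece c a = 0.
    move=> Dm em ne; rewrite /piece; case: pselect => // Dc; apply: indicator0.
    case=> m' hm' em'; move: ne; rewrite (ortho _ _ hm') => /eqP; apply.
    by congr truncm; apply: Dinj; [exact: orthoD hm'|exact: Dm|rewrite em'].
  have [ha|na] := pselect (exists m, lincomb v m = a); last first.
    rewrite indicator0 // big1 // => c _; rewrite /piece.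
    by case: pselect => // Dc; apply: indicator0; case=> m _ em; apply: na; exists m.
  rewrite indicator1 //; have [m Dm em] := exD a ha.
  pose c : {ffun 'I_k -> 'I_C.+1} := [ffun e => inord (minn (m e) C)].
  have ec : box c = truncm C m.
    by apply/mnmP=> e; rewrite !mnmE ffunE inordK // ltnS geq_minr.
  rewrite (bigD1 c) //= [X in _ + X]big1 ?addr0 => [|c' ne]; last first.
    apply: (pieceN _ _ Dm em); rewrite -ec; apply: contraNneq ne => e.
    apply/eqP/ffunP=> x; apply/val_inj.
    by move/mnmP/(_ x): e; rewrite !mnmE.
  rewrite /piece; case: pselect => [Dc|]; last first.
    case; rewrite ec; apply: hD Dm; apply/mnm_lepP=> e.
    by rewrite mnmE geq_minl.
  apply/esym/indicator1; exists m => //; rewrite ec; split.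
    by apply/mnm_lepP=> e; rewrite mnmE geq_minl.
  move=> e; rewrite mem_filter mem_enum andbT ec mnmE => ne.
  case: (leqP (m e) C) => [//|lt]; move: ne.
  by rewrite (minn_idPr (ltnW lt)) eqxx.
rewrite act_sumr; apply: fin_supp_sum => c.
suff : fin_supp ((\prod_e ('X_[u e] - 'X_[w e])) ** piece c) by [].
rewrite /piece; case: pselect => [Dc|nDc] /=; last first.
  by apply: fin_supp_act; exact: fin_supp0.
rewrite (bigID (mem (l c))) /= mulrC actM; apply: fin_supp_act.
have ul : uniq (l c) by rewrite filter_uniq ?enum_uniq.
rewrite -big_uniq //=; apply: fin_supp_orthant => // m m' hm hm'.
exact: Dinj (orthoD _ _ Dc hm) (orthoD _ _ Dc hm').
Qed.

Lemma fin_supp_semigroup n (E : seq ('X_{1..n} * 'X_{1..n})) (S : 'rV[int]_n -> Prop) :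
  (forall a, S a <->
    semigroup_gen (fun g => exists2 e, e \in E & g = mnm_vec e.2 - mnm_vec e.1) a) ->
  fin_supp ((\prod_(e <- E) ('X_[e.1] - 'X_[e.2])) ** indicator_series S).
Proof.
move=> hS; rewrite big_tnth.
have := @fin_supp_lincomb n _ (fun e => (tnth (in_tuple E) e).1)
  (fun e => (tnth (in_tuple E) e).2).
congr fin_supp; congr poly_mul_series; congr indicator_series.
apply/funext=> a; apply/propext; rewrite hS -semigroup_lincomb.
suff -> : (fun g => exists2 e, e \in E & g = mnm_vec e.2 - mnm_vec e.1) =
  (fun g => exists e, g = mnm_vec (tnth (in_tuple E) e).2 -
                          mnm_vec (tnth (in_tuple E) e).1).
  by [].
apply/funext=> g; apply/propext; split=> [[e]|[e ->]].
  by case/(tnthP (in_tuple E)) => i -> ->; exists i.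
by exists (tnth (in_tuple E) e) => //; exact: mem_tnth.
Qed.

(** * Rationality of the semigroup series of a basis *)

Lemma laurent0_mono n (m m' : 'X_{1..n}) : mdeg m = mdeg m' ->
  polyF 'X_[m] / polyF 'X_[m'] \in @laurent0 n.
Proof.
move=> e; apply/asboolP; exists (m', 'X_[m]); split=> //=.
by rewrite dhomogX; apply/eqP.
Qed.

Lemma xvar_neq0 n (i : 'I_n) : xvar i != 0.
Proof. exact: polyFX_neq0. Qed.

Lemma laurent0_ratio n (i j : 'I_n) : xvar i / xvar j \in @laurent0 n.
Proof. by apply: laurent0_mono; rewrite !mdeg1. Qed.

(** Dividing by the monomial x^w brings the degree back to 0. *)
Lemma shift_laurent0 n (s : series n) w : fin_supp s -> hom_supp (mdeg w)%:Z s ->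
  exists2 f, f \in @laurent0 n & series_rat s (polyF 'X_[w] * f).
Proof.
move=> fs hs; pose s' : series n := fun a => s (a + mnm_vec w).
have es : s = 'X_[w] ** s' by apply/funext=> a; rewrite actX /s' subrK.
have [||f hf hr] := @finite_laurent0 n s'.
- have [R hR] := fs; exists (R + mdeg w)%N => a /hR h t; have := h t.
  have : (w t <= mdeg w)%N by rewrite mdegE (bigD1 t) //= leq_addr.
  by rewrite !mxE; move: (a 0 t) (w t) (mdeg w) => x y z; lia.
- move=> a /hs; rewrite coord_sumD coord_sum_mnm => /(canRL (addrK _)).
  by rewrite subrr.
by exists f => //; rewrite es; apply: series_rat_act.
Qed.

Lemma dhomog_prodr n (J : finType) (A : {pred J}) (k : J -> nat)
    (F : J -> {mpoly int[n]}) : (forall x, x \in A -> F x \is (k x).-homog) ->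
  \prod_(x in A) F x \is (\sum_(x in A) k x)%N.-homog.
Proof.
move=> h; elim/big_ind2: _ => //; first exact: dhomog1.
by move=> p a q b; exact: dhomogM.
Qed.

Lemma dhomog_subX n (i j : 'I_n) : 'X_i - 'X_j \is [in int[n], 1.-homog].
Proof. by rewrite rpredB // dhomogX; apply/eqP; exact: mdeg1. Qed.

Definition exchanges n d (M : matroid n d) (I : {set 'I_n}) :=
  [set p : 'I_n * 'I_n | [&& p.1 \in I, p.2 \notin I & (p.2 |: I) :\ p.1 \in bases M]].

Definition crossing n (I : {set 'I_n}) :=
  [set p : 'I_n * 'I_n | (p.1 \in I) && (p.2 \notin I)].

Lemma crossing_exchanges n d (M : matroid n d) I :
  crossing I :&: exchanges M I = exchanges M I.
Proof. by apply/setIidPr/subsetP=> p; rewrite !inE => /and3P[-> ->]. Qed.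

Lemma S_semigroup n d (M : matroid n d) I a : S_ M I a <->
  semigroup_gen (fun g => exists2 e : 'X_{1..n} * 'X_{1..n},
    e \in [seq (U_(p.1), U_(p.2))%MM | p <- enum (exchanges M I)]
    & g = mnm_vec e.2 - mnm_vec e.1) a.
Proof.
rewrite /S_; suff -> : exchange_vec M I = (fun g => exists2 e : 'X_{1..n} * 'X_{1..n},
    e \in [seq (U_(p.1), U_(p.2))%MM | p <- enum (exchanges M I)]
    & g = mnm_vec e.2 - mnm_vec e.1) by [].
apply/funext=> g; apply/propext.
split=> [[i [j [hi hj hb ->]]]|[e /mapP[[i j] h ->] ->]].
  exists (U_(i), U_(j))%MM; last by rewrite !mnm_vec1.
  by apply/mapP; exists (i, j) => //; rewrite mem_enum inE /= hi hj hb.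
move: h; rewrite mem_enum inE => /and3P[/= hi hj hb]; exists i, j.
by rewrite !mnm_vec1.
Qed.

Lemma semigroup_genS n (G : 'rV[int]_n -> Prop) a b :
  semigroup_gen G a -> semigroup_gen G b -> semigroup_gen G (a + b).
Proof.
move=> ha hb; elim: ha => [|g c hg _ IH]; first by rewrite add0r.
by rewrite -addrA; apply: semigroup_genD.
Qed.

Lemma semigroup_gen1 n (G : 'rV[int]_n -> Prop) g : G g -> semigroup_gen G g.
Proof.
by move=> h; rewrite -[g]addr0; apply: semigroup_genD => //; apply: semigroup_gen0.
Qed.

Lemma semigroup_genMn n (G : 'rV[int]_n -> Prop) g k : G g -> semigroup_gen G (g *+ k).
Proof.
move=> hg; elim: k => [|k IH]; first by rewrite mulr0n; apply: semigroup_gen0.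
by rewrite mulrS; apply: semigroup_genD.
Qed.

Lemma coord_sum_evec n (i : 'I_n) : coord_sum (evec i) = 1.
Proof. by rewrite -mnm_vec1 coord_sum_mnm mdeg1. Qed.

Lemma hom_hseries n d (M : matroid n d) I : hom_supp 0 (hseries M I).
Proof.
move=> a; rewrite /hseries /indicator_series; case: asboolP => // h _.
elim: h => [|g b [i [j [_ _ _ ->]]] _ IH].
  by rewrite /coord_sum big1 // => t _; rewrite mxE.
by rewrite coord_sumD coord_sumB !coord_sum_evec IH subrr.
Qed.

Lemma exchange_fin_supp n d (M : matroid n d) I :
  fin_supp ((\prod_(p in exchanges M I) ('X_(p.1) - 'X_(p.2))) ** hseries M I).
Proof.
have := fin_supp_semigroup (S_semigroup M I).
by rewrite big_map big_enum.
Qed.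

Lemma hom_supp_act0 n (p : {mpoly int[n]}) k s :
  p \is k.-homog -> hom_supp 0 s -> hom_supp k%:Z (p ** s).
Proof. by move=> hp hs; rewrite -[k%:Z]add0r; apply: hom_supp_act. Qed.

Lemma prod_oneB n (P : {set 'I_n * 'I_n}) :
  \prod_(p in P) (1 - xvar p.2 / xvar p.1) =
  polyF (\prod_(p in P) ('X_(p.1) - 'X_(p.2))) / polyF 'X_[\sum_(p in P) U_(p.1)]
  :> ratfun n.
Proof.
rewrite -mprodXE !rmorph_prod -prodf_div; apply: eq_bigr => p _.
by rewrite rmorphB /= mulrBl divff ?xvar_neq0.
Qed.

(** The numerator is the finite series left after multiplying by one factor per
    exchange; dividing x_i - x_j by x_i makes it of degree 0. *)
Lemma hseries_rat n d (M : matroid n d) I :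
  exists2 f, f \in @laurent0 n
    & series_rat (hseries M I)
        (f / \prod_(p in exchanges M I) (1 - xvar p.2 / xvar p.1)).
Proof.
set q : {mpoly int[n]} := \prod_(p in exchanges M I) ('X_(p.1) - 'X_(p.2)).
pose w := (\sum_(p in exchanges M I) U_(p.1))%MM : 'X_{1..n}.
have hq : q \is (mdeg w).-homog.
  by rewrite mdeg_sum; apply: dhomog_prodr => p _; rewrite mdeg1 dhomog_subX.
have q0 : q != 0.
  apply/prodf_neq0 => p; rewrite inE => /and3P[h1 h2 _]; rewrite subr_eq0.
  apply: contraNneq h2 => /(congr1 (mcoeff U_(p.1)%MM)) /eqP.
  rewrite !mcoeffXU eqxx; have [-> //|_] := eqVneq p.2 p.1.
  by rewrite oner_eq0.
have [f hf hr] := shift_laurent0 (@exchange_fin_supp n d M I)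
   (hom_supp_act0 hq (@hom_hseries n d M I)).
exists f => //; rewrite prod_oneB -/q -/w.
have := series_rat_div q0 hr; congr series_rat.
by rewrite invf_div mulrCA mulrA.
Qed.

Lemma h_series_rat n d (M : matroid n d) I : series_rat (hseries M I) (h_ M I).
Proof.
by have [f _ h] := hseries_rat M I; rewrite /h_ (rat_of_seriesE h).
Qed.

Lemma prod_crossing n (I : {set 'I_n}) (R : comNzRingType) (F : 'I_n -> 'I_n -> R) :
  \prod_(i in I) \prod_(j in ~: I) F i j = \prod_(p in crossing I) F p.1 p.2.
Proof.
rewrite pair_big_dep /=; apply: eq_bigl => p; by rewrite !inE.
Qed.

Lemma oneB_neq0 n (i j : 'I_n) : i != j -> 1 - xvar i / xvar j != 0.
Proof.
move=> ne; rewrite -(divff (xvar_neq0 j)) -mulrBl mulf_neq0 ?invr_eq0 ?xvar_neq0 //.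
rewrite -rmorphB polyF_eq0 subr_eq0; apply/eqP => /(congr1 (mcoeff U_(i)%MM)) /eqP.
by rewrite !mcoeffXU eqxx (eq_sym j) (negbTE ne).
Qed.

(** The factors of f_I at the exchanges cancel the denominator of h_I; only the
    factors at the other pairs survive. *)
Lemma f_crossing n d (M : matroid n d) I : I \in bases M ->
  exists2 g, g \in @laurent0 n &
    f_ M I = g * \prod_(p in crossing I :\: exchanges M I) (1 - xvar p.2 / xvar p.1).
Proof.
move=> hI; have [g hg hr] := hseries_rat M I; exists g => //.
rewrite /f_ hI prod_crossing /h_ (rat_of_seriesE hr).
rewrite [X in _ * X](big_setID (exchanges M I)) /= mulrA crossing_exchanges.
congr (_ * _); rewrite divfK //; apply/prodf_neq0 => p; rewrite inE => /and3P[h1 h2 _].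
by apply: oneB_neq0; apply: contraNneq h2 => ->.
Qed.

Lemma f_laurent0 n d (M : matroid n d) I : f_ M I \in @laurent0 n.
Proof.
have [hI|nI] := boolP (I \in bases M); last by rewrite /f_ (negbTE nI) rpred0.
have [g hg ->] := f_crossing hI; rewrite rpredM // rpred_prod // => p _.
by rewrite rpredB ?rpred1 ?laurent0_ratio.
Qed.

Lemma f_nonexchange n d (M : matroid n d) I i j : I \in bases M ->
  i \in I -> j \notin I -> (j |: I) :\ i \notin bases M ->
  exists2 g, g \in @laurent0 n & f_ M I = (1 - xvar j / xvar i) * g.
Proof.
move=> hI hi hj hb; have [g hg ->] := f_crossing hI.
rewrite (bigD1 (i, j)) /=; last by rewrite !inE /= hi hj hb.
rewrite mulrCA; eexists; last by [].
rewrite rpredM // rpred_prod // => p _.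
by rewrite rpredB ?rpred1 ?laurent0_ratio.
Qed.

Lemma eqmod_sym n (m u v : ratfun n) : eqmod_Lambda m u v -> eqmod_Lambda m v u.
Proof. by move=> [g hg e]; exists (- g); rewrite ?rpredN // mulrN -e opprB. Qed.

(** The two moduli differ by the factor - x_i / x_j, a unit of Lambda. *)
Lemma eqmod_swap n (i j : 'I_n) u v :
  eqmod_Lambda (1 - xvar i / xvar j) u v -> eqmod_Lambda (1 - xvar j / xvar i) u v.
Proof.
move=> [g hg e]; exists (- (xvar i / xvar j) * g).
  by rewrite rpredM ?rpredN ?laurent0_ratio.
rewrite e mulrA; congr (_ * g).
rewrite [RHS]mulrN [in RHS]mulrBl mul1r mulf_div (mulrC (xvar j)) divff ?opprB //.
by rewrite mulf_neq0 ?xvar_neq0.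
Qed.

(** * Series that vanish at both ends of every line *)

Definition vanishes_along n (s : series n) (v : 'rV[int]_n) :=
  forall a, exists K, forall k, (K <= k)%N -> s (a + v *+ k) = 0.

Lemma vanishes_alongD n (s s' : series n) v :
  vanishes_along s v -> vanishes_along s' v -> vanishes_along (s \+ s') v.
Proof.
move=> h h' a; have [K hK] := h a; have [K' hK'] := h' a.
exists (maxn K K') => k; rewrite geq_max => /andP[l l'].
by rewrite /= hK // hK' // addr0.
Qed.

Lemma vanishes_along_act n (p : {mpoly int[n]}) s v :
  vanishes_along s v -> vanishes_along (p ** s) v.
Proof.
move=> h a; rewrite /poly_mul_series; elim: (msupp p) => [|m r [K IH]].
  by exists 0%N => k _; rewrite big_nil.
have [K' hK'] := h (a - mnm_vec m); exists (maxn K K') => k.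
rewrite geq_max => /andP[l l']; rewrite big_cons IH // addr0.
by rewrite addrAC hK' // mulr0.
Qed.

(** Along a line parallel to v the values of s change only where (X_i - X_j) ** s
    is nonzero.  From a point outside a large box, one of the two directions
    never meets that finite support again, so the value at the point
    equals the value far away, which is 0. *)
Lemma fin_supp_line n (i j : 'I_n) (s : series n) (v := evec j - evec i) :
  i != j -> fin_supp (('X_i - 'X_j) ** s) ->
  vanishes_along s v -> vanishes_along s (- v) -> fin_supp s.
Proof.
move=> ne [R hR] up down.
have const b : s b != s (b - v) -> forall t, (absz (b 0%R t) <= R.+1)%N.
  move=> hb; have /hR h : (('X_i - 'X_j) ** s) (b + evec i) != 0.
    rewrite actB /= !actX !mnm_vec1 addrK subr_eq0.
    suff -> : b + evec i - evec j = b - v by [].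
    by rewrite /v opprB addrA.
  move=> t; have := h t; rewrite !mxE; case: (_ && _);
    move: (b 0 t) => x; lia.
have vE t : v 0 t = (t == j)%:R - (t == i)%:R by rewrite !mxE !eqxx.
have hup b : (forall k : nat, exists t,
    (R.+1 < absz ((b + v *+ k.+1)%R 0%R t))%N) -> s b = 0.
  move=> h; have [K hK] := up b; rewrite -(hK K (leqnn K)) => {hK}.
  elim: K => [|K IH]; first by rewrite mulr0n addr0.
  rewrite {}IH; apply/eqP; rewrite eq_sym; apply: contraPT (h K) => hne [t].
  have /const/(_ t) : s (b + v *+ K.+1) != s (b + v *+ K.+1 - v).
    by rewrite mulrSr addrA addrK -addrA -mulrSr.
  by rewrite leqNgt => /negP.
have hdown b : (forall k : nat, exists t,
    (R.+1 < absz ((b + (- v) *+ k)%R 0%R t))%N) -> s b = 0.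
  move=> h; have [K hK] := down b; rewrite -(hK K (leqnn K)) => {hK}.
  elim: K => [|K IH]; first by rewrite mulr0n addr0.
  rewrite {}IH; apply/eqP; apply: contraPT (h K) => hne [t].
  have /const/(_ t) : s (b + (- v) *+ K) != s (b + (- v) *+ K - v).
    by rewrite -addrA -mulrSr.
  by rewrite leqNgt => /negP.
exists R.+1 => b hb t; rewrite leqNgt; apply: contra_neqN hb => lt.
have upE k u : (b + v *+ k.+1) 0 u = b 0 u + ((u == j)%:R - (u == i)%:R) *+ k.+1.
  by rewrite mxE mulmxnE vE.
have downE k u : (b + (- v) *+ k) 0 u = b 0 u - ((u == j)%:R - (u == i)%:R) *+ k.
  by rewrite mulNrn !mxE mulmxnE vE.
have aux1 (x : int) k : (R.+1 < absz x)%N -> 0 <= x ->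
    (R.+1 < absz (x + (1 - 0) *+ k)%R)%N.
  by rewrite subr0 -[1 *+ k]/(k%:R) natz; lia.
have aux2 (x : int) k : (R.+1 < absz x)%N -> ~~ (0 <= x) ->
    (R.+1 < absz (x + (0 - 1) *+ k)%R)%N.
  by rewrite sub0r mulNrn -[1 *+ k]/(k%:R) natz; lia.
have [ej|nj] := eqVneq t j.
  have [ge|lt0] := boolP (0 <= b 0 t).
    apply: hup => k; exists t; rewrite upE ej eqxx eq_sym (negbTE ne) -ej.
    exact: aux1.
  apply: hdown => k; exists t; rewrite downE ej eqxx eq_sym (negbTE ne) -ej.
  by rewrite -mulNrn opprB; apply: aux2.
have [ei|ni] := eqVneq t i.
  have [ge|lt0] := boolP (0 <= b 0 t).
    apply: hdown => k; exists t; rewrite downE ei eqxx (negbTE ne) -ei.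
    by rewrite -mulNrn opprB; apply: aux1.
  apply: hup => k; exists t; rewrite upE ei eqxx (negbTE ne) -ei.
  exact: aux2.
by apply: hup => k; exists t; rewrite upE (negbTE nj) (negbTE ni) subr0 mul0rn addr0.
Qed.

(** * Comparison of two adjacent bases *)

Lemma exchange_in_S n d (M : matroid n d) (i j : 'I_n) (I : {set 'I_n}) :
  i \in I -> j \notin I -> (j |: I) :\ i \in bases M -> S_ M I (evec j - evec i).
Proof. by move=> hi hj hb; apply: semigroup_gen1; exists i, j. Qed.

Lemma setU1_swap n (B : {set 'I_n}) i b : i \notin B -> b \notin i |: B ->
  (b |: (i |: B)) :\ i = b |: B.
Proof.
move=> hi; rewrite !inE negb_or => /andP[ne hb]; apply/setP=> x; rewrite !inE.
by have [->|] := eqVneq x i; rewrite /= ?orbF // eq_sym (negbTE ne) (negbTE hi).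
Qed.

(** Modulo v both monoids have the same generators.  The only ones in doubt are
    e_b - e_x with x in B and b outside both bases; if exchanging x for b
    is allowed in I and not in J, then basis exchange between J and
    B - x + i + b forces B + b and B - x + i + j to be bases, and e_b - e_x is
    the sum (e_b - e_j) + (e_i - e_x) + v. *)
Lemma exchange_project n d (M : matroid n d) (B : {set 'I_n}) i j a :
  i != j -> i \notin B -> j \notin B ->
  i |: B \in bases M -> j |: B \in bases M -> S_ M (i |: B) a ->
  exists k, S_ M (j |: B) (a - (evec j - evec i) *+ k).
Proof.
move=> nij hi hj bI bJ; set v := evec j - evec i.
have [ni nj] : i \notin j |: B /\ j \notin i |: B.
  by rewrite !inE !negb_or (eq_sym j) nij.
elim=> [|g c [x [b [hx hb hK ->]]] _ [k IH]].
  by exists 0%N; rewrite subr0; apply: semigroup_gen0.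
suff [k' hk'] : exists k', S_ M (j |: B) (evec b - evec x - v *+ k').
  exists (k' + k)%N; rewrite mulrnDr opprD addrACA; exact: semigroup_genS.
(* One step in the direction v suffices, except for the generators common to both
   monoids. *)
have [ex|nx] := eqVneq x i.
  exists 1%N; rewrite ex in hK hb *; rewrite setU1_swap // in hK.
  have -> : evec b - evec i - v *+ 1 = evec b - evec j.
    by rewrite mulr1n /v opprB addrA subrK.
  have [->|nb] := eqVneq b j; first by rewrite subrr; apply: semigroup_gen0.
  have hbJ : b \notin j |: B.
    by move: hb; rewrite !inE !negb_or nb => /andP[].
  apply: exchange_in_S => //; first by rewrite setU11.
  by rewrite setU1_swap.
have hxB : x \in B by move: hx; rewrite !inE (negbTE nx).
have nxj : x != j by apply: contraNneq hj => <-.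
have [eb|nb] := eqVneq b j.
  exists 1%N; have -> : evec b - evec x - v *+ 1 = evec i - evec x.
    by rewrite mulr1n /v eb opprB addrC addrA subrK.
  apply: exchange_in_S => //; first by rewrite !inE hxB orbT.
  suff -> : i |: (j |: B) = b |: (i |: B) by [].
  by rewrite eb setUCA.
move: (hb); rewrite !inE negb_or => /andP[nbi hbB].
have nbx : b != x by apply: contraNneq hbB => ->.
have hbJ : b \notin j |: B by rewrite !inE negb_or nb.
have hxJ : x \in j |: B by rewrite !inE hxB orbT.
have [hbx|hbx] := boolP ((b |: (j |: B)) :\ x \in bases M).
  by exists 0%N; rewrite subr0; apply: exchange_in_S.
exists 1%N.
have -> : evec b - evec x - v *+ 1 = (evec b - evec j) + (evec i - evec x).
  by rewrite mulr1n /v opprB [LHS]addrACA [RHS]addrACA; congr (_ + _); exact: addrC.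
set K := (b |: (i |: B)) :\ x in hK.
have iK : i \in K by rewrite !inE eq_sym nx eqxx orbT.
have bK : b \in K by rewrite !inE nbx eqxx.
have jK : j \notin K.
  rewrite !inE (eq_sym j b) (negbTE nb) (eq_sym j i) (negbTE nij).
  by rewrite (negbTE hj) andbF.
have xK : x \notin K by rewrite !inE eqxx.
apply: semigroup_genS.
  have iKJ : i \in K :\: (j |: B) by rewrite inE ni.
  have [y] := basis_exchange hK bJ iKJ.
  rewrite inE => /andP[yK yJ] hy; apply: exchange_in_S => //; first exact: setU11.
  rewrite setU1_swap //.
  have ey : y = x.
    apply/eqP; apply: contraNT hbx => nyx.
    suff -> : (b |: (j |: B)) :\ x = y |: (K :\ i) by [].
    have -> : y = j.
      move: yJ yK; rewrite !inE => /orP[/eqP //|yB].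
      by rewrite yB !orbT nyx.
    apply/setP=> z; rewrite !inE.
    have [->|nzx] := eqVneq z x; first by rewrite (negbTE nxj) andbF.
    have [->|nzj] := eqVneq z j; first by rewrite orbT.
    have [->|nzi] := eqVneq z i; last by [].
    by rewrite eq_sym (negbTE nbi) (negbTE hi).
  suff -> : b |: B = y |: (K :\ i) by [].
  rewrite ey; apply/setP=> z; rewrite !inE.
  have [->|nzx] := eqVneq z x; first by rewrite hxB orbT.
  have [->|nzi] := eqVneq z i; last by [].
  by rewrite eq_sym (negbTE nbi) (negbTE hi).
have xJK : x \in (j |: B) :\: K by rewrite inE xK.
have [y] := basis_exchange bJ hK xJK.
rewrite inE => /andP[yJ yK] hy; apply: exchange_in_S => //.
suff -> : (i |: (j |: B)) :\ x = y |: ((j |: B) :\ x) by [].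
have -> : y = i.
  move: yJ yK hy; rewrite !inE negb_or => /andP[nyj yB] /andP[nyx].
  rewrite (negbTE yB) orbF => /orP[/eqP->|/eqP //].
  move=> hy; case/negP: hbx.
  suff <- : b |: ((j |: B) :\ x) = (b |: (j |: B)) :\ x by [].
  apply/setP=> z; rewrite !inE.
  by have [->|] := eqVneq z b; rewrite ?nbx.
apply/setP=> z; rewrite !inE.
by have [->|] := eqVneq z i; rewrite ?(eq_sym i) ?nx.
Qed.

(** The union of the half lines from the points of S_I in the direction - v: when v
    is a generator of S_I, a union of full lines parallel to v. *)
Definition line_hull n d (M : matroid n d) I (v : 'rV[int]_n) : 'rV[int]_n -> Prop :=
  fun a => exists k, S_ M I (a + v *+ k).

Lemma S_line_up n d (M : matroid n d) (I : {set 'I_n}) i j a k : i \in I -> j \notin I ->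
  (j |: I) :\ i \in bases M -> S_ M I a -> S_ M I (a + (evec j - evec i) *+ k).
Proof.
move=> hi hj hb ha; apply: semigroup_genS => //; apply: semigroup_genMn.
by exists i, j.
Qed.

Lemma line_hull_shift n d (M : matroid n d) (I : {set 'I_n}) i j a k : i \in I -> j \notin I ->
  (j |: I) :\ i \in bases M ->
  line_hull M I (evec j - evec i) (a + (evec j - evec i) *+ k) <->
  line_hull M I (evec j - evec i) a.
Proof.
move=> hi hj hb; split=> -[k' h].
  by exists (k + k')%N; rewrite mulrnDr addrA.
by exists k'; rewrite addrAC; apply: S_line_up.
Qed.

(** The coordinates outside I have a nonnegative sum on S_I, and that sum drops by
    1 with each step in the direction e_i - e_j. *)
Lemma hseries_vanishes_along n d (M : matroid n d) (I : {set 'I_n}) i j : i \in I -> j \notin I ->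
  vanishes_along (hseries M I) (- (evec j - evec i)).
Proof.
move=> hi hj a.
pose l (b : 'rV[int]_n) := \sum_(t in ~: I) b 0 t.
have lD b c : l (b + c) = l b + l c.
  by rewrite /l -big_split; apply: eq_bigr => t _; rewrite mxE.
have lN b : l (- b) = - l b.
  by rewrite /l -sumrN; apply: eq_bigr => t _; rewrite mxE.
have lMn b k : l (b *+ k) = l b *+ k.
  elim: k => [|k IH]; last by rewrite !mulrS lD IH.
  by rewrite !mulr0n /l big1 // => t _; rewrite mxE.
have le x : l (evec x) = (x \notin I)%:R.
  have [hx|hx] := boolP (x \in I).
    rewrite /l big1 // => t; rewrite inE mxE eqxx /=.
    by case: eqP => // ->; rewrite hx.
  rewrite /l (bigD1 x) ?inE //= mxE !eqxx big1 ?addr0 // => t /andP[_ ne].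
  by rewrite mxE (negbTE ne).
have lS b : S_ M I b -> 0 <= l b.
  elim=> [|g c [x [y [hx hy _ ->]]] _ IH]; first by rewrite /l big1 // => t _; rewrite mxE.
  by rewrite !lD lN !le hx hy subr0 Num.Theory.addr_ge0.
exists (absz (l a)).+1 => k lek; apply: indicator0 => /lS.
rewrite lD lMn lN lD lN !le hi hj subr0.
suff h (x : int) : ((absz x).+1 <= k)%N -> ~ (0 <= x + (- 1) *+ k) by exact: h.
by rewrite mulNrn -[1 *+ k]/(k%:R) natz; lia.
Qed.

Lemma hull_diff_vanishes_along n d (M : matroid n d) (I : {set 'I_n}) i j :
  i \in I -> j \notin I -> (j |: I) :\ i \in bases M ->
  vanishes_along (hseries M I \- indicator_series (line_hull M I (evec j - evec i)))
    (evec j - evec i).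
Proof.
move=> hi hj hb a; have [[K hK]|nh] := pselect (line_hull M I (evec j - evec i) a).
  exists K => k le; rewrite /= /hseries !indicator1 ?subrr //.
    by apply/line_hull_shift => //; exists K.
  by rewrite -(subnKC le) mulrnDr addrA; apply: S_line_up.
exists 0%N => k _; rewrite /= /hseries !indicator0 ?subrr //.
  by move/(@line_hull_shift _ _ M I i j a k hi hj hb).
by move=> h; apply: nh; exists k.
Qed.

Lemma line_hull_exchange n d (M : matroid n d) (B : {set 'I_n}) i j :
  i != j -> i \notin B -> j \notin B -> i |: B \in bases M -> j |: B \in bases M ->
  line_hull M (i |: B) (evec j - evec i) = line_hull M (j |: B) (evec i - evec j).
Proof.
move=> nij hi hj bI bJ.
have half i' j' a : i' != j' -> i' \notin B -> j' \notin B ->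
    i' |: B \in bases M -> j' |: B \in bases M ->
    line_hull M (i' |: B) (evec j' - evec i') a ->
    line_hull M (j' |: B) (evec i' - evec j') a.
  move=> nij' hi' hj' bI' bJ' [k /(exchange_project nij' hi' hj' bI' bJ')[k' h]].
  exists k'; have := @S_line_up _ _ M (j' |: B) j' i' _ k _ _ _ h.
  rewrite -(opprB (evec i')) !mulNrn opprK addrAC subrK; apply.
  - exact: setU11.
  - by rewrite !inE negb_or nij'.
  by rewrite setU1_swap // !inE negb_or nij'.
apply/funext=> a; apply/propext; split; apply: half => //.
by rewrite eq_sym.
Qed.

Definition same_action n (s : series n) (p q : {mpoly int[n]}) := p ** s = q ** s.

Lemma same_actionM n (s : series n) p p' q q' :
  same_action s p q -> same_action s p' q' -> same_action s (p * p') (q * q').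
Proof. by rewrite /same_action => h h'; rewrite !actM h' actC h actC. Qed.

Lemma same_actionXn n (s : series n) p q k :
  same_action s p q -> same_action s (p ^+ k) (q ^+ k).
Proof.
by move=> h; elim: k => [//|k IH]; rewrite !exprS; apply: same_actionM.
Qed.

Lemma same_actionB n (s : series n) p p' q q' :
  same_action s p q -> same_action s p' q' -> same_action s (p - p') (q - q').
Proof. by rewrite /same_action => h h'; rewrite !actB h h'. Qed.

Lemma same_action_prod n (s : series n) (J : finType) (A : {pred J}) F G :
  (forall x, x \in A -> same_action s (F x) (G x)) ->
  same_action s (\prod_(x in A) F x) (\prod_(x in A) G x).
Proof.
move=> h; elim/big_ind2: _ => // p p' q q'; exact: same_actionM.
Qed.

(** The polynomial r_I of the introductory comment without its monomial: the
    factors of [crossing_poly] of B + i other than X_i - X_j. *)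
Definition swap_factor n (B : {set 'I_n}) (i j : 'I_n) : {mpoly int[n]} :=
  let N := ~: (i |: (j |: B)) in
  (\prod_(b in N) ('X_i - 'X_b)) * (\prod_(a in B) ('X_a - 'X_j)) *
  \prod_(a in B) \prod_(b in N) ('X_a - 'X_b).

Definition crossing_poly n (I : {set 'I_n}) : {mpoly int[n]} :=
  \prod_(i in I) \prod_(j in ~: I) ('X_i - 'X_j).

Lemma crossing_polyE n (B : {set 'I_n}) i j : i != j -> i \notin B -> j \notin B ->
  crossing_poly (i |: B) = ('X_i - 'X_j) * swap_factor B i j.
Proof.
move=> nij hi hj; rewrite /crossing_poly /swap_factor.
have -> : ~: (i |: B) = j |: ~: (i |: (j |: B)).
  apply/setP=> x; rewrite !inE; have [->|//] := eqVneq x j.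
  by rewrite eq_sym (negbTE nij).
set N := ~: _.
have jN : j \notin N by rewrite !inE eqxx orbT.
rewrite big_setU1 //= big_setU1 //=.
under [X in _ * X = _]eq_bigr do rewrite big_setU1 //=.
by rewrite big_split /= -!mulrA.
Qed.

Lemma swap_factor_homog n (B : {set 'I_n}) i j (c := #|~: (i |: (j |: B))|) :
  swap_factor B i j \is (c + #|B| + #|B| * c)%N.-homog.
Proof.
rewrite /swap_factor; apply: dhomogM; first apply: dhomogM.
- rewrite /c -sum1_card; apply: dhomog_prodr => x _; exact: dhomog_subX.
- rewrite -sum1_card; apply: dhomog_prodr => x _; exact: dhomog_subX.
rewrite -sum_nat_const; apply: dhomog_prodr => x _.
rewrite /c -sum1_card; apply: dhomog_prodr => y _; exact: dhomog_subX.
Qed.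

Lemma crossing_fin_supp n d (M : matroid n d) I :
  fin_supp (crossing_poly I ** hseries M I).
Proof.
rewrite /crossing_poly (prod_crossing I (fun i j => 'X_i - 'X_j)).
rewrite (big_setID (exchanges M I)) /= crossing_exchanges mulrC actM.
by apply: fin_supp_act; exact: exchange_fin_supp.
Qed.

Lemma f_crossing_poly n d (M : matroid n d) I : I \in bases M ->
  f_ M I = polyF (crossing_poly I) * h_ M I / polyF (\prod_(i in I) 'X_i ^+ #|~: I|).
Proof.
move=> hI; rewrite /f_ hI [polyF _ * _]mulrC -mulrA; congr (_ * _).
rewrite /crossing_poly !rmorph_prod -prodf_div; apply: eq_bigr => i _.
rewrite rmorph_prod rmorphXn /= -prodr_const -prodf_div; apply: eq_bigr => j _.
by rewrite rmorphB /= mulrBl divff ?xvar_neq0.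
Qed.

Fact degree_count x y : (x.+1 + (x + y + y * x) + 1 = x.+1 + x.+1 + y * x.+1)%N.
Proof. by lia. Qed.

(** Clears the denominators in the difference of f_I and f_J.  Stated for a
    morphism into an arbitrary field, so that the field arithmetic is done with an
    abstract carrier and does not unfold fractions of polynomials. *)
Lemma cross_difference (R : comNzRingType) (F : fieldType) (f : {rmorphism R -> F})
    (p q x y z w s t : R) (h h' g : F) :
  f s != 0 -> f t != 0 -> f z != 0 -> f y != 0 ->
  f (x - y) * (f w * g) = f (t * p) * h - f (s * q) * h' ->
  f p * h / f (s * z) - f q * h' / f (t * z) =
  (1 - f x / f y) * (- (f (w * y) / f (s * t * z)) * g).
Proof.
rewrite !rmorphM rmorphB.
move: (f p) (f q) (f x) (f y) (f z) (f w) (f s) (f t).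
move=> {}p {}q {}x {}y {}z {}w {}s {}t s0 t0 z0 y0 main.
have -> : p * h / (s * z) - q * h' / (t * z) =
   (t * p * h - s * q * h') / (s * t * z) by field; rewrite s0 t0 z0.
by rewrite -main; field; rewrite s0 t0 z0 y0.
Qed.

(** The case of two bases, by the series e described in the introductory comment. *)
Lemma f_congr n d (M : matroid n d) (B : {set 'I_n}) i j :
  i != j -> i \notin B -> j \notin B -> i |: B \in bases M -> j |: B \in bases M ->
  eqmod_Lambda (1 - xvar i / xvar j) (f_ M (i |: B)) (f_ M (j |: B)).
Proof.
move=> nij hi hj bI bJ; have nji : j != i by rewrite eq_sym.
set I := i |: B in bI *; set J := j |: B in bJ *.
have iI : i \in I by exact: setU11.
have jJ : j \in J by exact: setU11.
have jI : j \notin I by rewrite !inE negb_or nji.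
have iJ : i \notin J by rewrite !inE negb_or nij.
have bIJ : (j |: I) :\ i \in bases M by rewrite setU1_swap.
have bJI : (i |: J) :\ j \in bases M by rewrite setU1_swap.
pose N := ~: (i |: (j |: B)).
have eN : ~: (j |: (i |: B)) = N by rewrite /N setUCA.
have jN : j \notin N by rewrite !inE eqxx orbT.
have iN : i \notin N by rewrite !inE eqxx.
have cI : #|~: I| = #|N|.+1.
  have -> : ~: I = j |: N.
    apply/setP=> x; rewrite !inE; have [->|//] := eqVneq x j.
    by rewrite (negbTE nji).
  by rewrite cardsU1 jN.
have cJ : #|~: J| = #|N|.+1.
  have -> : ~: J = i |: N.
    apply/setP=> x; rewrite !inE; have [->|//] := eqVneq x i.
    by rewrite (negbTE nij).
  by rewrite cardsU1 iN.
set c := #|N|.+1 in cI cJ.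
set v := evec j - evec i; have vN : - v = evec i - evec j by rewrite opprB.
pose T := indicator_series (line_hull M I v).
have TJ : T = indicator_series (line_hull M J (- v)).
  by rewrite /T vN line_hull_exchange.
pose rI := 'X_j ^+ c * swap_factor B i j; pose rJ := 'X_i ^+ c * swap_factor B j i.
have XT : same_action T 'X_i 'X_j.
  apply/funext=> a; rewrite !actX !mnm_vec1 /T /indicator_series; congr (_%:R).
  have -> : a - evec i = a - evec j + v *+ 1 by rewrite mulr1n /v addrA subrK.
  by congr (nat_of_bool _); apply/asbool_equiv_eq/line_hull_shift.
have rT : rI ** T = rJ ** T.
  have XX b : same_action T ('X_i - 'X_b) ('X_j - 'X_b) by apply: same_actionB.
  apply: same_actionM.
    by apply: same_actionXn; apply: esym.
  rewrite /swap_factor eN -/N; apply: same_actionM => //; apply: same_actionM.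
    by apply: same_action_prod => b _; apply: XX.
  by apply: same_action_prod => a _; apply: same_actionB => //; apply: esym.
(* Subtracting rI ** T does not change (X_i - X_j) ** e, and cancels the two
   constant ends of the other terms on each line. *)
pose e := ((rI ** hseries M I) \+ (rJ ** hseries M J)) \- (rI ** T).
have de : ('X_i - 'X_j) ** e =
    ('X_j ^+ c * crossing_poly I) ** hseries M I \-
    ('X_i ^+ c * crossing_poly J) ** hseries M J.
  rewrite /I /J (crossing_polyE nij) // (crossing_polyE nji) // -/I -/J.
  rewrite /e act_subr act_addr -!actM [X in _ \- X]actM.
  have -> : ('X_i - 'X_j) * rI = 'X_j ^+ c * (('X_i - 'X_j) * swap_factor B i j).
    by rewrite /rI mulrCA.
  have -> : ('X_i - 'X_j) * rJ = - ('X_i ^+ c * (('X_j - 'X_i) * swap_factor B j i)).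
    by rewrite /rJ mulrCA -mulrN -mulNr opprB.
  rewrite actC actB XT; apply/funext=> a /=.
  rewrite -[X in X ** hseries M J]sub0r actB act0p /= sub0r.
  have -> : (rI ** (('X_j ** T) \- ('X_j ** T))) a = 0.
    by rewrite /poly_mul_series big1 // => m _; rewrite /= subrr mulr0.
  by rewrite subr0.
have fin_e : fin_supp e.
  apply: (fin_supp_line nij).
  - rewrite de !actM; apply: fin_suppB; apply: fin_supp_act; exact: crossing_fin_supp.
  - have -> : e = (rI ** (hseries M I \- T)) \+ (rJ ** hseries M J).
      by rewrite act_subr; apply/funext=> a; rewrite /= addrAC.
    apply: vanishes_alongD; apply: vanishes_along_act; first exact: hull_diff_vanishes_along.
    by rewrite -[evec j - evec i]opprB; apply: hseries_vanishes_along.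
  have -> : e = (rI ** hseries M I) \+ (rJ ** (hseries M J \- T)).
    by rewrite act_subr -rT; apply/funext=> a; rewrite /= addrA.
  apply: vanishes_alongD; apply: vanishes_along_act; first exact: hseries_vanishes_along.
  by rewrite TJ vN; apply: hull_diff_vanishes_along.
pose k := (c + (#|N| + #|B| + #|B| * #|N|))%N.
have Xc (x : 'I_n) : 'X_x ^+ c \is [in int[n], c.-homog].
  rewrite -[X in X.-homog]mul1n; apply: dhomogMn; rewrite dhomogX.
  by apply/eqP; exact: mdeg1.
have hom_rI : rI \is k.-homog by apply: dhomogM => //; apply: swap_factor_homog.
have hom_rJ : rJ \is k.-homog.
  by apply: dhomogM => //; have := swap_factor_homog B j i; rewrite eN.
have hom_T : hom_supp 0 T.
  move=> a; rewrite /T /indicator_series; case: asboolP => // -[k' h] _.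
  have := @hom_hseries n d M I (a + v *+ k').
  rewrite /hseries indicator1 // => /(_ isT) <-.
  rewrite coord_sumD; suff -> : coord_sum (v *+ k') = 0 by rewrite addr0.
  elim: k' {h} => [|k' IH]; first by rewrite mulr0n /coord_sum big1 // => t _; rewrite mxE.
  by rewrite mulrS coord_sumD IH coord_sumB !coord_sum_evec subrr.
have hom_e : hom_supp k%:Z e.
  apply: hom_suppB; last exact: hom_supp_act0.
  move=> a; have [z|/(hom_supp_act0 hom_rI (@hom_hseries n d M I)) //] :=
    eqVneq ((rI ** hseries M I) a) 0.
  rewrite /= z add0r; exact: (hom_supp_act0 hom_rJ (@hom_hseries n d M J)).
pose w := (U_(i) *+ k)%MM : 'X_{1..n}.
have dw : mdeg w = k by rewrite mdegMn mdeg1 mul1n.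
have [||g hg hr] := @shift_laurent0 n e w; [by []| by rewrite dw |].
have main : polyF ('X_i - 'X_j) * (polyF 'X_[w] * g) =
    polyF ('X_j ^+ c * crossing_poly I) * h_ M I -
    polyF ('X_i ^+ c * crossing_poly J) * h_ M J :> ratfun n.
  apply: (@series_rat_inj n (('X_i - 'X_j) ** e)); first exact: series_rat_act.
  rewrite de; apply: series_ratB; apply: series_rat_act; exact: h_series_rat.
pose mB := (\sum_(a in B) U_(a) *+ c)%MM : 'X_{1..n}.
have XB : \prod_(a in B) 'X_a ^+ c = 'X_[mB] :> {mpoly int[n]}.
  by rewrite /mB -mprodXE; apply: eq_bigr => a _; rewrite mpolyXn.
pose m := (U_(i) *+ c + U_(j) *+ c + mB)%MM : 'X_{1..n}.
have dm : mdeg (w + U_(j))%MM = mdeg m.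
  rewrite /m /mB !mdegD dw !mdegMn !mdeg1 mdeg_sum.
  under eq_bigr do rewrite mdegMn mdeg1.
  rewrite sum_nat_const /k /c !mul1n; exact: degree_count.
(* x_j comes from 1 - x_i / x_j = (x_j - x_i) / x_j, x^m from the denominators of
   f_I and f_J, and x^w from the degree of e. *)
exists (- (polyF 'X_[w + U_(j)] / polyF 'X_[m]) * g).
  by rewrite rpredM // rpredN laurent0_mono.
rewrite !f_crossing_poly // cI cJ /I /J !big_setU1 //= XB -/I -/J.
rewrite (mpolyXD _ w) /m (mpolyXD _ _ mB) (mpolyXD _ (_ *+ c)%MM) /xvar.
rewrite -(mpolyXn _ U_(i) c) -(mpolyXn _ U_(j) c).
apply: cross_difference; last exact: main.
- by rewrite polyF_eq0 expf_neq0 // -polyF_eq0 polyFX_neq0.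
- by rewrite polyF_eq0 expf_neq0 // -polyF_eq0 polyFX_neq0.
- exact: polyFX_neq0.
exact: polyFX_neq0.
Qed.

Lemma f_congruence n d (M : matroid n d) (B : {set 'I_n}) i j :
  i \notin B -> j \notin B ->
  eqmod_Lambda (1 - xvar i / xvar j) (f_ M (i |: B)) (f_ M (j |: B)).
Proof.
move=> hi hj; have [<-|nij] := eqVneq i j.
  by exists 0; rewrite ?rpred0 // mulr0 subrr.
have nji : j != i by rewrite eq_sym.
have one i' j' : i' != j' -> i' \notin B -> j' \notin B -> i' |: B \in bases M ->
    j' |: B \notin bases M ->
    eqmod_Lambda (1 - xvar j' / xvar i') (f_ M (i' |: B)) (f_ M (j' |: B)).
  move=> ne hi' hj' bI bJ; have hj2 : j' \notin i' |: B.
    by rewrite !inE negb_or eq_sym ne.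
  have [|g hg ->] := f_nonexchange bI (setU11 _ _) hj2; first by rewrite setU1_swap.
  by exists g => //; rewrite /f_ (negbTE bJ) subr0.
have [bI|nI] := boolP (i |: B \in bases M); have [bJ|nJ] := boolP (j |: B \in bases M).
- exact: f_congr.
- by apply: eqmod_swap; apply: one.
- by apply: eqmod_sym; apply: one.
by exists 0; rewrite ?rpred0 // /f_ (negbTE nI) (negbTE nJ) mulr0 subrr.
Qed.

Theorem proposition12p6 (n d : nat) (M : matroid n d) :
  [/\ forall I : {set 'I_n}, I \in bases M -> series_rat (hseries M I) (h_ M I),
      forall I : {set 'I_n}, #|I| = d -> f_ M I \in @laurent0 n,
      forall (B : {set 'I_n}) (i j : 'I_n),
        (#|B| + 1)%N = d -> i \notin B -> j \notin B ->
        eqmod_Lambda (1 - xvar i / xvar j) (f_ M (i |: B)) (f_ M (j |: B))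
    & exists (c : KT n d) (c0 : Kord n d),
        (forall I : dsubset n d, Lambda_val (KT_val c I) = f_ M (val I)) /\
        c0 = Kord_class c].
Proof.
split=> [I _|I _|B i j _|].
- exact: h_series_rat.
- exact: f_laurent0.
- exact: f_congruence.
pose F : {ffun dsubset n d -> (Lambda n)^o} :=
  [ffun I : dsubset n d => MkLambda (f_laurent0 M (val I))].
have hF : F \in @KT_cond n d.
  apply/asboolP => B i j I J hi hj eI eJ.
  by rewrite /F !ffunE /= eI eJ; apply: f_congruence.
exists (MkKT hF), (Kord_class (MkKT hF)); split=> // I.
by rewrite /= /F ffunE.
Qed.
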